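(* Let $K$ be a compact Hausdorff space, and let $\varphi\in(\mathrm{C}(K)^\delta)^\ast$, identified with a measure in $\mathrm{M}(\Sigma^{\mathcal{C}}_K,\mathcal{N}_K)$. Then $\varphi$ is $\sigma$-order continuous (as a functional on $\mathrm{C}(K)^\delta$) if and only if $\varphi$ is countably additive on $\Sigma^{\mathcal{C}}_K$ (as a measure).
   Context: $\mathrm{C}(K)^\delta$ is the Dedekind completion of the Banach lattice $\mathrm{C}(K)$ of continuous real-valued functions on $K$: the unique (up to linear lattice isometry) Dedekind complete Banach lattice containing $\mathrm{C}(K)$ as a majorizing, order dense (isometrically embedded) sublattice. $\mathcal{N}_K$ is the collection of meagre subsets of $K$, and $\Sigma^{\mathcal{C}}_K=\{U\Delta N: U\subseteq K\text{ open},\ N\in\mathcal{N}_K\}$ is the $\sigma$-algebra of sets with the property of Baire. $\mathrm{L}^\infty(\Sigma^{\mathcal{C}}_K,\mathcal{N}_K)$ is the vector lattice of bounded real-valued $\Sigma^{\mathcal{C}}_K$-measurable functions on $K$ modulo the ideal of those vanishing off a meagre set; the class of $u$ is $\hat u$, so $\hat f\le\hat g$ iff $\{x: f(x)>g(x)\}\in\mathcal{N}_K$, and the norm is $\|\hat f\|_\infty=\inf\{c\ge0:\{x:|f(x)|>c\}\in\mathcal{N}_K\}$. $\mathrm{C}(K)^\delta$ is identified with $\mathrm{L}^\infty(\Sigma^{\mathcal{C}}_K,\mathcal{N}_K)$ via $\mathrm{C}(K)\ni u\mapsto\hat u$. $\mathrm{M}(\Sigma^{\mathcal{C}}_K,\mathcal{N}_K)$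 is the Banach lattice of bounded finitely additive signed measures $\mu$ on $\Sigma^{\mathcal{C}}_K$ with $\mu(N)=0$ for all $N\in\mathcal{N}_K$ (setwise order, total variation norm). The dual $(\mathrm{C}(K)^\delta)^\ast$ is identified with $\mathrm{M}(\Sigma^{\mathcal{C}}_K,\mathcal{N}_K)$ via the isometric lattice isomorphism determined by $\varphi(\hat u)=\int_K u\,d\varphi$, so that $\varphi(A)=\varphi(\hat{\mathbf 1}_A)$ for $A\in\Sigma^{\mathcal{C}}_K$, where $\mathbf 1_A$ is the characteristic function of $A$; the same symbol is used for the functional and the measure. A norm bounded (equivalently order bounded) functional $\varphi$ on a Banach lattice $E$ is $\sigma$-order continuous if $\inf\{|\varphi(f_n)|:n\in\mathbb{N}\}=0$ whenever $(f_n)$ is a decreasing sequence in $E$ with infimum $0$. *)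

(* Defs.v *)
From HB Require Import structures.
From mathcomp Require Import all_boot all_order all_algebra.
From mathcomp Require Import generic_quotient ring_quotient.
From mathcomp Require Import all_classical all_reals all_analysis.
From mathcomp Require Import measurable_realfun.

Set Implicit Arguments.
Unset Strict Implicit.
Unset Printing Implicit Defensive.

Import Order.TTheory GRing.Theory Num.Theory.
Import numFieldNormedType.Exports.

Local Open Scope classical_set_scope.
Local Open Scope ring_scope.

Section BaireProperty.
Context {K : topologicalType}.
Implicit Types A B U N : set K.

Definition nowhere_dense A := (closure A)° = set0.

Definition meagre A :=
  exists2 F : nat -> set K, (forall n, nowhere_dense (F n)) & A = \bigcup_n F n.

Definition baire_property A :=
  exists U N, [/\ open U, meagre N & A = U `+` N].

Lemma nowhere_denseS A B : A `<=` B -> nowhere_dense B -> nowhere_dense A.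
Proof.
move=> AB B0; rewrite /nowhere_dense -subset0 -B0.
exact/interiorS/closureS.
Qed.

Lemma nowhere_dense0 : nowhere_dense set0.
Proof. by rewrite /nowhere_dense closure0 interior0. Qed.

Lemma meagreS A B : A `<=` B -> meagre B -> meagre A.
Proof.
move=> AB [F F0 BF]; exists (fun n => F n `&` A).
  by move=> n; apply: nowhere_denseS (F0 n) => x [].
by rewrite -setI_bigcupl -BF setIC; apply/esym/setIidl.
Qed.

Lemma meagre0 : meagre set0.
Proof.
exists (fun=> set0); first by move=> _; exact: nowhere_dense0.
by rewrite bigcup0.
Qed.

Lemma nowhere_dense_meagre A : nowhere_dense A -> meagre A.
Proof.
move=> A0; exists (fun=> A) => //.
by apply/seteqP; split=> [x Ax|x [n _]//]; exists 0%N.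
Qed.

Lemma meagre_bigcup (F : nat -> set K) :
  (forall n, meagre (F n)) -> meagre (\bigcup_n F n).
Proof.
move=> mF.
have /choice[G GF] n : exists G : nat -> set K,
    (forall m, nowhere_dense (G m)) /\ F n = \bigcup_m G m.
  by have [G ? ?] := mF n; exists G.
exists (fun k => if @unpickle (nat * nat)%type k is Some nm
                 then G nm.1 nm.2 else set0).
  move=> k; case: unpickle => [nm|]; last exact: nowhere_dense0.
  exact: (GF nm.1).1.
apply/seteqP; split=> x [n _].
  rewrite (GF n).2 => -[m _ Gx]; exists (pickle (n, m)) => //.
  by rewrite pickleK.
case: unpickle => // -[i j] /= Gx; exists i => //.
by rewrite (GF i).2; exists j.
Qed.

Lemma meagreU A B : meagre A -> meagre B -> meagre (A `|` B).
Proof.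
move=> mA mB; rewrite -bigcup2E; apply: meagre_bigcup => -[|[|n]] //=.
exact: meagre0.
Qed.

Lemma baire_propertyP A :
  baire_property A <-> exists2 U, open U & meagre (U `+` A).
Proof.
split=> [[U [N [oU mN ->]]]|[U oU mUA]].
  by exists U => //; rewrite setYA setYK set0Y.
by exists U, (U `+` A); split => //; rewrite setYA setYK set0Y.
Qed.

Lemma baire_property_open U : open U -> baire_property U.
Proof. by move=> oU; apply/baire_propertyP; exists U; rewrite ?setYK//; exact: meagre0. Qed.

Lemma baire_property_meagre N : meagre N -> baire_property N.
Proof.
by move=> mN; apply/baire_propertyP; exists set0; rewrite ?set0Y//; exact: open0.
Qed.

Lemma baire_propertyC A : baire_property A -> baire_property (~` A).
Proof.
move=> /baire_propertyP[U oU mUA]; apply/baire_propertyP.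
exists (~` U)°; first exact: open_interior.
have cU : closed (~` U) by exact: open_closedC.
apply: (@meagreS _ (((~` U) `\` (~` U)°) `|` (U `+` A))).
  move=> x /=; rewrite /setY /=.
  have : (~` U)° x -> (~` U) x by exact: interior_subset.
  by case: (pselect (U x)); case: (pselect (A x));
    case: (pselect ((~` U)° x)) => /=; tauto.
apply: meagreU => //; apply: nowhere_dense_meagre.
rewrite /nowhere_dense -subset0.
have cD : closed ((~` U) `\` (~` U)°).
  by rewrite setDE; apply: closedI => //; apply: open_closedC; exact: open_interior.
rewrite -(closure_id _).1// => x xD.
have [_] : ((~` U) `\` (~` U)°) x by exact: interior_subset xD.
by apply; apply: interiorS xD => y [].
Qed.

Lemma baire_property_bigcup (F : nat -> set K) :
  (forall n, baire_property (F n)) -> baire_property (\bigcup_n F n).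
Proof.
move=> bF.
have /choice[U UF] n : exists U, open U /\ meagre (U `+` F n).
  by have /baire_propertyP[U ? ?] := bF n; exists U.
apply/baire_propertyP; exists (\bigcup_n U n).
  by apply: bigcup_open => n _; exact: (UF n).1.
apply: (@meagreS _ (\bigcup_n (U n `+` F n))); last first.
  by apply: meagre_bigcup => n; exact: (UF n).2.
move=> x [[[n _ Ux] nF]|[[n _ Fx] nU]]; exists n => //.
  by left; split => // Fx; apply: nF; exists n.
by right; split => // Ux; apply: nU; exists n.
Qed.

Lemma sigma_algebra_baire_property :
  sigma_algebra setT (baire_property : set (set K)).
Proof.
split=> [|A bA|F bF].
- exact/baire_property_open/open0.
- by rewrite setTD; exact: baire_propertyC.
- exact: baire_property_bigcup.
Qed.

Lemma baire_propertyU A B :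
  baire_property A -> baire_property B -> baire_property (A `|` B).
Proof.
move=> mA mB; rewrite -bigcup2E; apply: baire_property_bigcup => -[|[|n]] //=.
exact/baire_property_open/open0.
Qed.

End BaireProperty.

(* Measurable types of the library are pointed whereas [K] may be empty; the
   library theory of measurable functions is thus applied to a copy of [K]
   that carries a point [x0]. *)
Definition pointed_copy (K : topologicalType) (x0 : K) : Type := K.

Section PointedCopy.
Context (K : topologicalType) (x0 : K).
HB.instance Definition _ := Choice.copy (pointed_copy x0) K.
HB.instance Definition _ := isPointed.Build (pointed_copy x0) x0.
HB.instance Definition _ := @isMeasurable.Build default_measure_display
  (pointed_copy x0) (@baire_property K) (baire_property_open open0)
  (@baire_propertyC K) (@baire_property_bigcup K).
End PointedCopy.

Section BoundedMeasurable.
Context (R : realType) (K : topologicalType).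
Implicit Types f g : K -> R.

Definition baire_measurable f :=
  forall B : set R, measurable B -> baire_property (f @^-1` B).

Definition bmfun : {pred K -> R} :=
  mem [set f | baire_measurable f /\ exists M, forall x, `|f x| <= M].

Lemma baire_measurableP (x0 : K) f :
  baire_measurable f <-> measurable_fun setT (f : pointed_copy x0 -> R).
Proof.
split=> [mf _ B mB|mf B mB].
  by rewrite setTI; exact: mf.
by have := mf measurableT B mB; rewrite setTI.
Qed.

Lemma baire_measurable_empty f : (K -> False) -> baire_measurable f.
Proof.
move=> K0 B _; suff -> : f @^-1` B = set0 by exact/baire_property_open/open0.
by rewrite -subset0 => x; case: (K0 x).
Qed.

Lemma baire_measurableD f g :
  baire_measurable f -> baire_measurable g -> baire_measurable (f + g).
Proof.
move=> mf mg; have [[x0 _]|K0] := pselect (exists x : K, True); last first.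
  by apply: baire_measurable_empty => x; apply: K0; exists x.
apply/(baire_measurableP x0).
by apply: measurable_funD; exact/(baire_measurableP x0).
Qed.

Lemma baire_measurableZ (a : R) f :
  baire_measurable f -> baire_measurable (a *: f).
Proof.
move=> mf; have [[x0 _]|K0] := pselect (exists x : K, True); last first.
  by apply: baire_measurable_empty => x; apply: K0; exists x.
apply/(baire_measurableP x0).
by apply: measurable_funM; [exact: measurable_cst|exact/(baire_measurableP x0)].
Qed.

Lemma baire_measurable_cst (a : R) : baire_measurable (cst a).
Proof.
have [[x0 _]|K0] := pselect (exists x : K, True); last first.
  by apply: baire_measurable_empty => x; apply: K0; exists x.
exact/(baire_measurableP x0)/measurable_cst.
Qed.

Lemma baire_measurable_indic (A : set K) :
  baire_property A -> baire_measurable (\1_A : K -> R).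
Proof.
move=> bA; have [[x0 _]|K0] := pselect (exists x : K, True); last first.
  by apply: baire_measurable_empty => x; apply: K0; exists x.
exact/(baire_measurableP x0)/(@measurable_indic _ (pointed_copy x0)).
Qed.

Lemma bmfun_submod_closed : submod_closed bmfun.
Proof.
split.
  rewrite inE; split; first exact: (@baire_measurable_cst 0).
  by exists 0 => x; rewrite normr0.
move=> a f g; rewrite !inE => -[mf [M Mf]] [mg [N Ng]]; split.
  by apply: baire_measurableD => //; exact: baire_measurableZ.
exists (`|a| * M + N) => x.
rewrite (le_trans (ler_normD _ _))// lerD//.
by rewrite normrM ler_wpM2l.
Qed.

HB.instance Definition _ := GRing.isSubmodClosed.Build R (K -> R) bmfun
  bmfun_submod_closed.

Record bmfunType := BMFun { bmfun_val :> K -> R ; _ : bmfun_val \in bmfun }.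

HB.instance Definition _ := [isSub for bmfun_val].
HB.instance Definition _ := [Choice of bmfunType by <:].
HB.instance Definition _ := [SubChoice_isSubLmodule of bmfunType by <:].

Definition null_bmfun : {pred bmfunType} :=
  mem [set f : bmfunType | meagre [set x | f x != 0]].

Lemma bmfunP (f : bmfunType) : (f : K -> R) \in bmfun. Proof. exact: valP. Qed.

Lemma null_bmfun_zmod_closed : zmod_closed null_bmfun.
Proof.
split.
  rewrite inE/=; apply: meagreS meagre0 => x /=.
  by rewrite eqxx.
move=> f g; rewrite !inE/= => mf mg; apply: meagreS (meagreU mf mg) => x h.
have [fx0|] := eqVneq (f x) 0; last by left.
have [gx0|] := eqVneq (g x) 0; last by right.
case/negP: h; apply/eqP; change (f x - g x = 0).
by rewrite fx0 gx0 subrr.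
Qed.

HB.instance Definition _ := GRing.isZmodClosed.Build bmfunType null_bmfun
  null_bmfun_zmod_closed.

(* [L^oo(Sigma, N)], the bounded measurable functions modulo the ideal of those
   that vanish off a meagre set. For [K] compact Hausdorff, it is the concrete
   form of the Dedekind completion of [C(K)], a continuous function being sent
   to its class. The order and the norm are defined below. *)
Definition Linf : Type := {ideal_quot null_bmfun}.

HB.instance Definition _ := GRing.Zmodule.on Linf.
HB.instance Definition _ := EqQuotient.on Linf.

End BoundedMeasurable.

Section Linf.
Context {R : realType} {K : topologicalType}.
Local Notation L := (Linf R K).
Implicit Types (f g : bmfunType R K) (u v w : L).
Local Open Scope quotient_scope.

Lemma Linf_eqP f g :
  (\pi_L f = \pi_L g) <-> meagre [set x | f x != g x].
Proof.
have -> : [set x | f x != g x] = [set x | (f - g) x != 0].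
  apply/funext => x; change ((f x != g x : Prop) = (f x - g x != 0)).
  by rewrite subr_eq0.
have := Quotient.idealrBE (@null_bmfun R K) f g; rewrite [X in X = _]inE/= => e.
split=> [/eqP|mfg]; first by rewrite -e => /asboolP.
by apply/eqP; rewrite -e; exact/asboolP.
Qed.

Lemma Linf_piD f g : \pi_L (f + g) = \pi_L f + \pi_L g.
Proof. exact: Quotient.pi_add. Qed.

Definition Linf_scale (a : R) u : L := \pi_L (a *: repr u).

Lemma Linf_piZ a f : \pi_L (a *: f) = Linf_scale a (\pi_L f).
Proof.
apply/Linf_eqP.
have /Linf_eqP := esym (reprK (\pi_L f)); apply: meagreS => x /=.
by apply: contra => /eqP e; apply/eqP; congr (_ * _).
Qed.

Lemma Linf_ind (P : L -> Prop) : (forall f, P (\pi_L f)) -> forall u, P u.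
Proof. by move=> Pf u; rewrite -[u]reprK. Qed.

Lemma Linf_scalerA a b u : Linf_scale a (Linf_scale b u) = Linf_scale (a * b) u.
Proof.
by elim/Linf_ind: u => f; rewrite -!Linf_piZ scalerA.
Qed.

Lemma Linf_scale1r : left_id 1 Linf_scale.
Proof. by elim/Linf_ind => f; rewrite -Linf_piZ scale1r. Qed.

Lemma Linf_scalerDr : right_distributive Linf_scale +%R.
Proof.
move=> a; elim/Linf_ind => f; elim/Linf_ind => g.
by rewrite -Linf_piD -!Linf_piZ -Linf_piD scalerDr.
Qed.

Lemma Linf_scalerDl u : {morph Linf_scale^~ u : a b / a + b}.
Proof.
by move=> a b; elim/Linf_ind: u => f; rewrite -!Linf_piZ -Linf_piD scalerDl.
Qed.

HB.instance Definition _ := GRing.Zmodule_isLmodule.Build R L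
  Linf_scalerA Linf_scale1r Linf_scalerDr Linf_scalerDl.

Definition Linf_le u v := `[< meagre [set x | repr u x > repr v x] >].
Definition Linf_lt u v := (v != u) && Linf_le u v.

Lemma meagre_neq_repr f : meagre [set x | f x != repr (\pi_L f) x].
Proof. by apply/Linf_eqP; rewrite reprK. Qed.

Lemma Linf_leP f g : Linf_le (\pi_L f) (\pi_L g) <-> meagre [set x | f x > g x].
Proof.
have mfg := meagreU (meagre_neq_repr f) (meagre_neq_repr g).
split=> [/asboolP|] mle.
  apply: meagreS (meagreU mfg mle) => x /= gf.
  have [e1|] := eqVneq (f x) (repr (\pi_L f) x); last by left; left.
  have [e2|] := eqVneq (g x) (repr (\pi_L g) x); last by left; right.
  by right; rewrite -e1 -e2.
apply/asboolP; apply: meagreS (meagreU mfg mle) => x /= gf.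
have [e1|] := eqVneq (f x) (repr (\pi_L f) x); last by left; left.
have [e2|] := eqVneq (g x) (repr (\pi_L g) x); last by left; right.
by right; rewrite e1 e2.
Qed.

Lemma Linf_le_refl : reflexive Linf_le.
Proof.
elim/Linf_ind => f; apply/Linf_leP; apply: meagreS meagre0 => x /=.
by rewrite ltxx.
Qed.

Lemma Linf_le_anti : antisymmetric Linf_le.
Proof.
elim/Linf_ind => f; elim/Linf_ind => g /andP[/Linf_leP fg /Linf_leP gf].
apply/Linf_eqP; apply: meagreS (meagreU fg gf) => x /=.
by case: (ltgtP (f x) (g x)) => // h _; [right|left].
Qed.

Lemma Linf_le_trans : transitive Linf_le.
Proof.
elim/Linf_ind => g; elim/Linf_ind => f; elim/Linf_ind => h.
move=> /Linf_leP fg /Linf_leP gh; apply/Linf_leP.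
apply: meagreS (meagreU fg gh) => x /= hf.
by have [gf|fg'] := ltP (g x) (f x); [left|right; exact: lt_le_trans hf fg'].
Qed.

HB.instance Definition _ := Order.isPOrder.Build ring_display L
  (fun _ _ => erefl) Linf_le_refl Linf_le_anti Linf_le_trans.

Definition Linf_norm u : R :=
  inf [set c : R | 0 <= c /\ meagre [set x | `|repr u x| > c]].

Lemma Linf_normE f :
  Linf_norm (\pi_L f) = inf [set c : R | 0 <= c /\ meagre [set x | `|f x| > c]].
Proof.
congr inf; apply/seteqP; split=> c /= [c0 mc]; split=> //;
    apply: meagreS (meagreU (meagre_neq_repr f) mc) => x /= cx.
  have [e|] := eqVneq (f x) (repr (\pi_L f) x); last by left.
  by right; rewrite -e.
have [e|] := eqVneq (f x) (repr (\pi_L f) x); last by left.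
by right; rewrite e.
Qed.

Lemma Linf_norm_lb f :
  has_lbound [set c : R | 0 <= c /\ meagre [set x | `|f x| > c]].
Proof. by exists 0 => c []. Qed.

Lemma Linf_norm_le f c :
  Linf_norm (\pi_L f) <= c <-> 0 <= c /\ meagre [set x | `|f x| > c].
Proof.
rewrite Linf_normE; set S := [set _ | _].
have S0 : S !=set0.
  have := bmfunP f; rewrite inE => -[_ [M fM]]; exists `|M|; split => //.
  apply: meagreS meagre0 => x /=; rewrite ltNge => /negP; apply.
  exact: le_trans (fM x) (ler_norm _).
split=> [ic|cS]; last by apply: ge_inf => //; exact: Linf_norm_lb.
have iS e : 0 < e -> meagre [set x | `|f x| > c + e].
  move=> e0; have [|d [d0 md] dlt] := @inf_adherent _ S _ e0.
    by split => //; exact: Linf_norm_lb.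
  apply: meagreS md => x /=; apply: le_lt_trans.
  by rewrite (le_trans (ltW dlt))// lerD2r.
split; first by apply: le_trans ic; apply: lb_le_inf => // d [].
apply: (@meagreS _ _ (\bigcup_n [set x | `|f x| > c + n.+1%:R^-1])).
  move=> x /= cx; have : 0 < `|f x| - c by rewrite subr_gt0.
  move=> /(@ltr_add_invr _ 0)[n]; rewrite add0r => nlt.
  by exists n => //=; rewrite -ltrBrDl.
by apply: meagre_bigcup => n; apply: iS; rewrite invr_gt0.
Qed.

Lemma Linf_norm_ge0 u : 0 <= Linf_norm u.
Proof. by elim/Linf_ind: u => f; have /Linf_norm_le[] := lexx (Linf_norm (\pi_L f)). Qed.

Lemma Linf_normP f : meagre [set x | `|f x| > Linf_norm (\pi_L f)].
Proof. by have /Linf_norm_le[] := lexx (Linf_norm (\pi_L f)). Qed.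

Lemma Linf_ler_normD u v : Linf_norm (u + v) <= Linf_norm u + Linf_norm v.
Proof.
elim/Linf_ind: u => f; elim/Linf_ind: v => g.
rewrite -Linf_piD; apply/Linf_norm_le; split.
  by rewrite addr_ge0// Linf_norm_ge0.
apply: meagreS (meagreU (Linf_normP f) (Linf_normP g)) => x /= h.
have [fx|] := leP `|f x| (Linf_norm (\pi_L f)); last by left.
have [gx|] := leP `|g x| (Linf_norm (\pi_L g)); last by right.
move: h; rewrite ltNge => /negP; case.
by rewrite (le_trans (ler_normD _ _))// lerD.
Qed.

Lemma Linf_normZ_le a u : Linf_norm (a *: u) <= `|a| * Linf_norm u.
Proof.
elim/Linf_ind: u => f.
have -> : a *: \pi_L f = \pi_L (a *: f) by rewrite Linf_piZ.
apply/Linf_norm_le; split; first by rewrite mulr_ge0// Linf_norm_ge0.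
apply: meagreS (Linf_normP f) => x.
change (`|a| * Linf_norm (\pi_L f) < `|a * f x| ->
  Linf_norm (\pi_L f) < `|f x|).
rewrite normrM; have [->|a0] := eqVneq a 0; first by rewrite normr0 !mul0r ltxx.
by rewrite ltr_pM2l// normr_gt0.
Qed.

Lemma Linf_normZ a u : Linf_norm (a *: u) = `|a| * Linf_norm u.
Proof.
apply/eqP; rewrite eq_le Linf_normZ_le/=.
have [->|a0] := eqVneq a 0; first by rewrite normr0 mul0r Linf_norm_ge0.
rewrite -ler_pdivlMl ?normr_gt0// -normfV.
by rewrite -{1}[u]scale1r -(mulVf a0) -scalerA Linf_normZ_le.
Qed.

Lemma Linf_norm0_eq0 u : Linf_norm u = 0 -> u = 0.
Proof.
elim/Linf_ind: u => f f0; have -> : 0 = \pi_L 0 by rewrite pi_zeror.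
apply/Linf_eqP; have := Linf_normP f; rewrite f0; apply: meagreS => x /=.
by rewrite normr_gt0.
Qed.

HB.instance Definition _ := Lmodule_isNormed.Build R L
  Linf_ler_normD Linf_normZ Linf_norm0_eq0.

(* The class of a bounded measurable function, with value [0] on all other
   functions. *)
Definition Linf_class (h : K -> R) : L := \pi_L (insubd 0 h).

End Linf.

Definition sigma_order_continuous {R : realType} {E : porderZmodType}
    (phi : E -> R) :=
  forall f : nat -> E, nonincreasing_seq f -> infimums (range f) 0 ->
  inf (range (fun n => `|phi (f n)|)) = 0.

Section MeasureOfFunctional.
Context {R : realType} {K : topologicalType}.
Local Open Scope quotient_scope.

(* The functional [phi] and the measure [mu] correspond to each other when [phi]
   is the integral with respect to [mu], so that [mu] is recovered from [phi]
   through the indicator functions. Values on sets without the property of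
   Baire are irrelevant. *)
Definition measure_of (phi : Linf R K -> R) (A : set K) : R :=
  phi (Linf_class \1_A).

Definition countably_additive (mu : set K -> R) :=
  forall A : nat -> set K, (forall n, baire_property (A n)) ->
  trivIset setT A -> series (mu \o A) @ \oo --> mu (\bigcup_n A n).

(* Membership in [M(Sigma, N)]. *)
Definition bounded_charge (mu : set K -> R) :=
  [/\ forall A B, baire_property A -> baire_property B -> A `&` B = set0 ->
        mu (A `|` B) = mu A + mu B,
      exists M, forall A, baire_property A -> `|mu A| <= M &
      forall N, meagre N -> mu N = 0].

Lemma bmfun_indic (A : set K) :
  baire_property A -> (\1_A : K -> R) \in @bmfun R K.
Proof.
move=> bA; rewrite inE; split; first exact: baire_measurable_indic.
by exists 1 => x; rewrite indicE; case: (_ \in _); rewrite ?normr1 ?normr0.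
Qed.

Lemma bounded_charge_measure_of (phi : {linear Linf R K -> R^o}) :
  continuous phi -> bounded_charge (measure_of phi).
Proof.
move=> cphi.
have class_val A : baire_property A ->
    exists2 a : bmfunType R K, Linf_class \1_A = \pi a & (a : K -> R) = \1_A.
  move=> bA; exists (insubd 0 (\1_A : K -> R)) => //.
  by rewrite [LHS]insubdK//; exact: bmfun_indic.
split=> [A B bA bB AB0||N mN].
- rewrite /measure_of -linearD; congr (phi _).
  have [a -> ea] := class_val _ bA; have [b -> eb] := class_val _ bB.
  have [c -> ec] := class_val _ (baire_propertyU bA bB).
  rewrite -Linf_piD; congr (\pi _); apply/val_inj/funext => x.
  change (c x = a x + b x); rewrite ea eb ec !indicE in_setU.
  have [xA|] := boolP (x \in A); have [xB|] := boolP (x \in B) => //=;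
    rewrite ?addr0 ?add0r//.
  have /set_mem : x \in A `&` B by rewrite in_setI xA xB.
  by rewrite AB0.
- have /linear_bounded_continuous/linear_boundedP := cphi.
  move=> /pinfty_ex_gt0[M M0 phiM]; exists M => A bA.
  rewrite (le_trans (phiM _))// ger_pMr//.
  have [a -> ea] := class_val _ bA.
  apply/Linf_norm_le; split => //; apply: meagreS meagre0 => x /=.
  by rewrite ea indicE; case: (_ \in _); rewrite ?normr1 ?normr0 ltNge ?lexx// ler01.
- rewrite /measure_of (_ : Linf_class _ = 0) ?linear0//.
  have [a -> ea] := class_val _ (baire_property_meagre mN).
  have -> : 0 = \pi_(Linf R K) 0 by rewrite pi_zeror.
  apply/Linf_eqP; apply: meagreS mN => x /=; rewrite ea indicE.
  by have [/set_mem//|_] := boolP (x \in N); rewrite eqxx.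
Qed.

End MeasureOfFunctional.

(* Main.v *)
(* Both conditions say that [phi] is null along certain decreasing sequences.
   Along subsequences the condition [inf |phi f_n| = 0] upgrades to convergence
   [phi f_n --> 0], and countable additivity amounts to the special case of
   indicators of sets decreasing to the empty set. Conversely, let [f_n] decrease
   to [0] with [f_0 <= m d]. Off a meagre set, representatives decrease to [0]
   pointwise, and [f_n] is within [d] of the layer cake sum
   [d * \sum_(k < m) 1_{f_n > (k + 1) d}]. Each of these [m] level sets decreases
   to the empty set as [n] grows, so that [limsup |phi f_n| <= |phi| d]. *)
Require Import Defs.
From mathcomp Require Import all_boot all_order all_algebra.
From mathcomp Require Import all_classical all_reals all_analysis.
From mathcomp Require Import ring lra.

Import Order.TTheory GRing.Theory Num.Theory.
Import numFieldNormedType.Exports.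

Local Open Scope classical_set_scope.
Local Open Scope ring_scope.

(** * Algebra, order and norm on classes of bounded measurable functions *)

Section LinfClass.
Context {R : realType} {K : topologicalType}.
Local Open Scope quotient_scope.
Implicit Types (f g : K -> R) (u : Linf R K).

Lemma Linf_class_repr u : Linf_class (repr u : K -> R) = u.
Proof. by rewrite /Linf_class valKd reprK. Qed.

Lemma val_insubd_bmfun f : f \in @bmfun R K ->
  (insubd (0 : bmfunType R K) f : K -> R) = f.
Proof. by move=> bf; rewrite [LHS]insubdK. Qed.

Lemma Linf_classD f g : f \in @bmfun R K -> g \in @bmfun R K ->
  Linf_class (f + g) = Linf_class f + Linf_class g.
Proof.
move=> bf bg; rewrite /Linf_class -Linf_piD; congr (\pi _); apply/val_inj.
transitivity (f + g); first by apply: val_insubd_bmfun; exact: rpredD.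
change (f + g = (insubd (0 : bmfunType R K) f : K -> R) +
  (insubd (0 : bmfunType R K) g : K -> R)).
by rewrite !val_insubd_bmfun.
Qed.

Lemma Linf_classZ a f : f \in @bmfun R K ->
  Linf_class (a *: f) = a *: Linf_class f.
Proof.
move=> bf; rewrite /Linf_class.
transitivity (\pi_(Linf R K) (a *: insubd (0 : bmfunType R K) f)); last first.
  by rewrite Linf_piZ.
congr (\pi _); apply/val_inj.
transitivity (a *: f); first by apply: val_insubd_bmfun; exact: rpredZ.
change (a *: f = a *: (insubd (0 : bmfunType R K) f : K -> R)).
by rewrite val_insubd_bmfun.
Qed.

Lemma Linf_class0 : Linf_class (0 : K -> R) = 0.
Proof.
rewrite -[X in Linf_class X](scale0r (0 : K -> R)) Linf_classZ ?scale0r//.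
exact: rpred0.
Qed.

Lemma Linf_class_sum m (F : 'I_m -> K -> R) :
  (forall i, F i \in @bmfun R K) ->
  Linf_class (\sum_i F i) = \sum_i Linf_class (F i).
Proof.
elim: m F => [F _|m IH F bF].
  by rewrite !big_ord0 Linf_class0.
rewrite !big_ord_recl Linf_classD ?IH//; exact: rpred_sum.
Qed.

Lemma Linf_class_le f g : f \in @bmfun R K -> g \in @bmfun R K ->
  Linf_class f <= Linf_class g <-> meagre [set x | g x < f x].
Proof.
move=> bf bg.
have := @Linf_leP R K (insubd 0 f) (insubd 0 g).
by rewrite !val_insubd_bmfun.
Qed.

Lemma Linf_class_norm_le f c : f \in @bmfun R K -> 0 <= c ->
  meagre [set x | c < `|f x|] -> `|Linf_class f| <= c.
Proof.
move=> bf c0 mf; apply/Linf_norm_le; split => //.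
by rewrite val_insubd_bmfun.
Qed.

Lemma Linf_le_reprP u v : u <= v <-> meagre [set x | repr v x < repr u x].
Proof.
by rewrite -{1}[u]Linf_class_repr -{1}[v]Linf_class_repr;
  apply: Linf_class_le; exact: bmfunP.
Qed.

End LinfClass.

(** * Decreasing sequences of sets with the property of Baire: their indicators and their charges *)

Lemma baire_propertyD {K : topologicalType} (A B : set K) :
  baire_property A -> baire_property B -> baire_property (A `\` B).
Proof.
move=> bA bB; rewrite setDE -[A]setCK -setCU; apply: baire_propertyC.
by apply: baire_propertyU => //; exact: baire_propertyC.
Qed.

Section SetSequences.
Context {R : realType} {K : topologicalType}.
Implicit Type E : nat -> set K.

(** A point where a lower bound [u] is positive misses some [E n], so [u] exceeds [\1_(E n)] there.
    Hence [u] is positive only on a countable union of meagre sets. *)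
Lemma infimums_Linf_indic E : (forall n, baire_property (E n)) ->
  \bigcap_n E n = set0 ->
  infimums (range (fun n => Linf_class (\1_(E n) : K -> R))) 0.
Proof.
move=> bE E0.
have bmE n : (\1_(E n) : K -> R) \in @bmfun R K by exact: bmfun_indic.
split.
  move=> _ [n _ <-]; rewrite -Linf_class0; apply/Linf_class_le => //.
    exact: rpred0.
  apply: meagreS meagre0 => x /=; rewrite indicE.
  by rewrite ltNge ler0n.
move=> u lu; rewrite -[u]Linf_class_repr -Linf_class0; apply/Linf_class_le.
- exact: bmfunP.
- exact: rpred0.
apply: (@meagreS _ _ (\bigcup_n [set x | \1_(E n) x < repr u x])).
  move=> x /= ux; apply: contrapT => nx.
  have : (\bigcap_n E n) x.
    move=> n _; apply: contrapT => nE; apply: nx; exists n => //=.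
    by rewrite indicE memNset.
  by rewrite E0.
apply: meagre_bigcup => n; apply/Linf_class_le => //; first exact: bmfunP.
by rewrite Linf_class_repr; apply: lu; exists n.
Qed.

Lemma nonincreasing_Linf_indic E : (forall n, baire_property (E n)) ->
  (forall n, E n.+1 `<=` E n) ->
  nonincreasing_seq (fun n => Linf_class (\1_(E n) : K -> R)).
Proof.
move=> bE dE; apply/nonincreasing_seqP => n.
apply/Linf_class_le; [exact: bmfun_indic..|].
apply: meagreS meagre0 => x /=; rewrite !indicE ltr_nat.
by case: (boolP (x \in E n.+1)) => [/set_mem/dE/mem_set ->|_]; rewrite ?ltn0.
Qed.

End SetSequences.

Section Charges.
Context {R : realType} {K : topologicalType}.
Implicit Types (mu : set K -> R) (E : nat -> set K).

Lemma bounded_chargeD mu A B : bounded_charge mu ->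
  baire_property A -> baire_property B -> B `<=` A ->
  mu A = mu (A `\` B) + mu B.
Proof.
move=> [muU _ _] bA bB BA; rewrite -[in LHS](setDUK BA) setUC muU//.
  exact: baire_propertyD.
by rewrite setDE -setIA setICl setI0.
Qed.

(** The differences [E n \ E n.+1] are disjoint with union [E 0]. Their partial sums telescope to
    [mu (E 0) - mu (E n)] and tend to [mu (E 0)]. *)
Lemma countably_additive_cvg0 mu E : bounded_charge mu ->
  countably_additive mu -> (forall n, baire_property (E n)) ->
  (forall n, E n.+1 `<=` E n) -> \bigcap_n E n = set0 ->
  mu \o E @ \oo --> 0.
Proof.
move=> cmu amu bE dE E0.
have dEle m n : (m <= n)%N -> E n `<=` E m.
  elim: n => [|n IH]; first by rewrite leqn0 => /eqP ->.
  rewrite leq_eqVlt ltnS => /orP[/eqP -> //|/IH mn].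
  exact: subset_trans (dE n) mn.
pose A n := E n `\` E n.+1.
have bA n : baire_property (A n) by exact: baire_propertyD.
have tA : trivIset setT A.
  apply: ltn_trivIset => m n mn; rewrite -subset0 => x [[_ nx] [xn _]].
  by apply: nx; exact: dEle xn.
have UA : \bigcup_n A n = E 0%N.
  apply/seteqP; split => [x [n _ [xn _]]|x x0]; first exact: dEle xn.
  (* By induction, a point of [E 0] outside every difference would remain in all [E n]. *)
  apply: contrapT => nx.
  have : (\bigcap_n E n) x.
    move=> n _; elim: n => // n IH.
    by apply: contrapT => nE; apply: nx; exists n.
  by rewrite E0.
have sA n : series (mu \o A) n = mu (E 0%N) - mu (E n).
  elim: n => [|n IH]; first by rewrite /series/= big_geq// subrr.
  rewrite seriesSr IH /= (bounded_chargeD _ _ _ cmu (bE n) (bE n.+1))//.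
  by rewrite -/(A n); lra.
have := amu A bA tA; rewrite UA => cA.
rewrite (_ : mu \o E = (fun n => mu (E 0%N) - series (mu \o A) n)).
  by rewrite -[X in _ --> X](subrr (mu (E 0%N))); apply: cvgB => //; exact: cvg_cst.
by apply/funext => n /=; rewrite sA subKr.
Qed.

End Charges.

(** * From sigma-order continuity to countable additivity *)

(* Only an infimum is assumed to vanish, but it does so along every subsequence. *)
Lemma sigma_order_continuous_cvg0 {R : realType} {E : porderZmodType}
    (phi : E -> R) (f : nat -> E) : sigma_order_continuous phi ->
  nonincreasing_seq f -> infimums (range f) 0 -> phi \o f @ \oo --> 0.
Proof.
move=> sphi df [lf uf]; apply: contrapT => ncvg.
have [e e0 Pe] : exists2 e : R, 0 < e &
    forall N : nat, exists n : nat, (N <= n)%N && (e <= `|phi (f n)|).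
  apply: contrapT => nP; apply: ncvg; apply/cvgrPdist_lt => e e0.
  have [N PN] : exists N : nat, forall n, (N <= n)%N -> `|phi (f n)| < e.
    apply: contrapT => nN; apply: nP; exists e => // N.
    apply: contrapT => nn; apply: nN; exists N => n Nn.
    by rewrite ltNge; apply/negP => en; apply: nn; exists n; rewrite Nn.
  by exists N => // n /= /PN; rewrite sub0r normrN.
have [c cP] := choice Pe.
(* As [c N] is an index at least [N] where [phi] stays at least [e] in absolute value, applying [c]
   to the successor makes [s] strictly increasing. *)
pose s k := iter k (c \o S) (c 0%N).
have ss k : (s k < s k.+1)%N by case/andP: (cP (s k).+1).
have se k : e <= `|phi (f (s k))|.
  by case: k => [|k]; [case/andP: (cP 0%N)|case/andP: (cP (s k).+1)].
have ks k : (k <= s k)%N by elim: k => // k IH; exact: leq_ltn_trans IH (ss k).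
have := sphi (f \o s); rewrite /= => /(_ _ _)/wrap[].
- by apply/nonincreasing_seqP => k; apply: df; exact: ltnW.
(* The subsequence keeps the infimum [0]: since [n <= s n], a lower bound of it is below every
   [f n]. *)
- split=> [_ [k _ <-]|u lu]; first by apply: lf; exists (s k).
  apply: uf => _ [n _ <-]; apply: le_trans (df _ _ (ks n)).
  by apply: lu; exists n.
move=> i0; have : e <= inf (range (fun n => `|phi (f (s n))|)).
  by apply: lb_le_inf => [|_ [k _ <-]//]; exists `|phi (f (s 0%N))|, 0%N.
by rewrite i0 leNgt e0.
Qed.

(** The tails [T n] of the union decrease to the empty set, so their measures tend to 0. By finite
    additivity these measures are the remainders of the series. *)
Lemma sigma_order_continuous_countably_additive {R : realType}
    {K : topologicalType} (phi : {linear Linf R K -> R^o}) :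
  continuous phi -> sigma_order_continuous phi ->
  countably_additive (measure_of phi).
Proof.
move=> cphi sphi A bA tA.
have cmu := bounded_charge_measure_of cphi.
pose T n := \bigcup_i A (n + i)%N.
have bT n : baire_property (T n) by exact: baire_property_bigcup.
have TS n : T n = A n `|` T n.+1.
  apply/seteqP; split => [x [[|i] _ Ax]|x [Ax|[i _ Ax]]].
  - by left; rewrite addn0 in Ax.
  - by right; exists i => //; rewrite addSnnS.
  - by exists 0%N => //; rewrite addn0.
  - by exists i.+1 => //; rewrite -addSnnS.
have AT n : A n `&` T n.+1 = set0.
  rewrite -subset0 => x [An [i _ Ai]].
  have : n = (n.+1 + i)%N by apply: tA => //; exists x.
  by move/eqP; rewrite addSn -addnS -[X in X == _]addn0 eqn_add2l.
have T0 : T 0%N = \bigcup_n A n by [].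
have ET : \bigcap_n T n = set0.
  (* A point of [T 0] lies in some [A i], which is disjoint from [T i.+1]. *)
  rewrite -subset0 => x Tx; have [i _ Ai] := Tx 0%N I.
  by rewrite -(AT i); split => //; exact: Tx.
have sA n : series (measure_of phi \o A) n =
    measure_of phi (T 0%N) - measure_of phi (T n).
  elim: n => [|n IH]; first by rewrite /series/= big_geq// subrr.
  have [muU _ _] := cmu.
  by rewrite seriesSr IH [T n]TS muU// opprD addrA addrAC subrK.
have cT : measure_of phi \o T @ \oo --> 0.
  apply: (sigma_order_continuous_cvg0 _ _ sphi).
    by apply: nonincreasing_Linf_indic => // n; rewrite [T n]TS; right.
  exact: infimums_Linf_indic.
rewrite -T0 (_ : series _ = fun n => measure_of phi (T 0%N) - measure_of phi (T n)).
  rewrite -[X in _ --> X]subr0; apply: cvgB => //; exact: cvg_cst.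
exact/funext.
Qed.

(** * From countable additivity to sigma-order continuity *)

(** The sum counts the positive multiples of [d] strictly below [y], so [d] times it is [y] rounded
    down to the grid, up to one step. *)
Lemma layer_cake_bounds {R : realType} (d y : R) (m : nat) : 0 < d -> 0 <= y ->
  y <= m%:R * d ->
  `|y - d * \sum_(k < m) ((k.+1%:R * d < y)%R : nat)%:R| <= d.
Proof.
move=> d0 y0 ym; set S := \sum_(k < m) _.
suff [Sy yS] : d * S <= y /\ (y <= m%:R * d -> y - d <= d * S).
  by have := yS ym; rewrite ler_norml; lra.
(* The bound [y <= m%:R * d] is not inherited by smaller [m]. The induction therefore also records
   that all [m] terms equal 1 when [y] lies above the last level. *)
have : d * S <= y /\ (if y <= m%:R * d then (y - d <= d * S : Prop) else S = m%:R).
  rewrite {}/S {ym}; elim: m => [|m [IH1 IH2]].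
    rewrite big_ord0 mulr0 mul0r; split => //.
    by case: ifP => // y0'; lra.
  rewrite big_ord_recr/=; set S := \sum_(k < m) _ in IH1 IH2 *.
  have e : m.+1%:R = m%:R + 1 :> R by rewrite -natr1.
  rewrite e; move: IH2; case: (leP y (m%:R * d)) => ym IH2.
    have ym1 : y <= (m%:R + 1) * d by lra.
    rewrite ym1 (_ : _ < y = false) ?addr0//.
    by rewrite ltNge ym1.
  rewrite IH2; case: (leP y ((m%:R + 1) * d)) => ym1 /=; rewrite ?addr0 ?mulr1n; last by split => //; lra.
  by split; lra.
by move=> [-> h]; split => // {}ym; rewrite ym in h.
Qed.

Section CountablyAdditive.
Context {R : realType} {K : topologicalType}.
Implicit Type f : nat -> Linf R K.

Lemma baire_property_superlevel (g : bmfunType R K) (t : R) :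
  baire_property [set x | t < g x].
Proof.
have := bmfunP g; rewrite inE => -[mg _].
have := mg `]t, +oo[%classic (measurable_itv _); congr baire_property.
by apply/seteqP; split=> x /=; rewrite in_itv/= andbT.
Qed.

(* On the intersection [B], every [f n] is bounded below by the class of
   [t *: \1_B], hence so is their infimum [0]. *)
Lemma infimums_Linf_meagre f (t : R) : 0 < t -> infimums (range f) 0 ->
  meagre (\bigcap_n [set x | t < repr (f n) x]).
Proof.
move=> t0 [lf uf]; set B := \bigcap_n _.
have bB : baire_property B.
  rewrite -[B]setCK /B setC_bigcap; apply/baire_propertyC.
  apply: baire_property_bigcup => n; apply: baire_propertyC.
  exact: baire_property_superlevel.
have bmB : t *: (\1_B : K -> R) \in @bmfun R K by exact/rpredZ/bmfun_indic.
have bm0 : (0 : K -> R) \in @bmfun R K by exact: rpred0.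
have : Linf_class (t *: (\1_B : K -> R)) <= Linf_class (0 : K -> R).
  rewrite Linf_class0; apply: uf => _ [n _ <-].
  rewrite -[f n]Linf_class_repr; apply/Linf_class_le => //; first exact: bmfunP.
  (* Off [B] the comparison function is 0, so there it suffices that [f n] is nonnegative up to a
     meagre set. *)
  have : meagre [set x | repr (f n) x < 0].
    rewrite -[X in meagre X]/[set x | repr (f n) x < (0 : K -> R) x].
    apply/Linf_class_le => //; first exact: bmfunP.
    by rewrite Linf_class_repr Linf_class0; apply: lf; exists n.
  apply: meagreS => x.
  change (repr (f n) x < t * \1_B x -> repr (f n) x < 0).
  rewrite indicE; case: (boolP (x \in B)) => [/set_mem Bx|_].
    by rewrite mulr1 => /lt_trans/(_ (Bx n I)); rewrite ltxx.
  by rewrite mulr0.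
move=> /Linf_class_le => /(_ bmB bm0); apply: meagreS => x Bx.
change (0 < t * \1_B x).
by rewrite indicE mem_set// mulr1.
Qed.

Lemma countably_additive_sigma_order_continuous
    (phi : {linear Linf R K -> R^o}) :
  continuous phi -> countably_additive (measure_of phi) ->
  sigma_order_continuous phi.
Proof.
move=> cphi aphi f df inf0.
have cmu := bounded_charge_measure_of cphi.
pose E n t : set K := [set x | t < repr (f n) x].
have bE n t : baire_property (E n t) by exact: baire_property_superlevel.
(* The exceptional set: some representative is negative, or monotonicity fails, or all
   representatives stay above some [j.+1%:R^-1]. *)
pose N := \bigcup_n [set x | repr (f n) x < 0] `|`
  (\bigcup_n [set x | repr (f n) x < repr (f n.+1) x] `|`
   \bigcup_j \bigcap_n E n j.+1%:R^-1).
have mN : meagre N.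
  apply: meagreU; last apply: meagreU; apply: meagre_bigcup => n.
  - rewrite -[X in meagre X]/[set x | repr (f n) x < (0 : K -> R) x].
    apply/Linf_class_le; [exact: rpred0|exact: bmfunP|].
    by rewrite Linf_class_repr Linf_class0; apply: inf0.1; exists n.
  - by apply/Linf_le_reprP; exact: df.
  - by apply: infimums_Linf_meagre => //; rewrite invr_gt0.
(* With [N] removed, the level sets decrease to the empty set exactly, not merely up to a meagre
   set. *)
pose D n t := E n t `\` N.
have bD n t : baire_property (D n t).
  exact/baire_propertyD/baire_property_meagre.
have cD (t : R) : 0 < t -> measure_of phi \o D^~ t @ \oo --> 0.
  move=> t0; apply: countably_additive_cvg0 => //.
    move=> n x [Ex Nx]; split => //; apply: lt_le_trans Ex _.
    by rewrite leNgt; apply/negP => h; apply: Nx; right; left; exists n.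
  rewrite -subset0 => x Dx; have [_] := Dx 0%N I; apply; right; right.
  have [j jt] := @ltr_add_invr R 0 t t0; rewrite add0r in jt.
  by exists j => // n _; apply: lt_trans jt _; have [] := Dx n I.
have [M fM] : exists M : R, forall x, `|repr (f 0%N) x| <= M.
  by have := bmfunP (repr (f 0%N)); rewrite inE => -[].
(* By monotonicity off [N], the bound of [f 0] serves all [f n], so the number of levels will not
   depend on [n]. *)
have fNM n x : ~ N x -> 0 <= repr (f n) x <= M.
  move=> Nx; rewrite leNgt; apply/andP; split.
    by apply/negP => h; apply: Nx; left; exists n.
  apply: le_trans (le_trans (ler_norm _) (fM x)).
  elim: n => // n; apply: le_trans.
  by rewrite leNgt; apply/negP => h; apply: Nx; right; left; exists n.
have approx n m (d : R) : 0 < d -> M <= m%:R * d ->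
    `|f n - d *: \sum_(k < m) Linf_class (\1_(D n (k.+1%:R * d)) : K -> R)| <= d.
  move=> d0 Md; pose F (k : 'I_m) := \1_(D n (k.+1%:R * d)) : K -> R.
  have bF k : F k \in @bmfun R K by exact: bmfun_indic.
  have bS : \sum_k F k \in @bmfun R K by exact: rpred_sum.
  have bf : (repr (f n) : K -> R) \in @bmfun R K by exact: bmfunP.
  rewrite -Linf_class_sum// -scaleNr -Linf_classZ// -[f n]Linf_class_repr.
  rewrite -Linf_classD//; last exact: rpredZ.
  apply: Linf_class_norm_le => //; last 1 first.
  - apply: meagreS mN => x /= dx; apply: contrapT => Nx; move: dx.
    apply/negP; rewrite -leNgt.
    change (`|repr (f n) x + - d * (\sum_k F k) x| <= d).
    have /andP[f0 f1] := fNM n x Nx.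
    (* At [x] outside [N], membership in [D n t] just says [t < repr (f n) x], which turns the
       indicators into the layer cake count. *)
    rewrite fct_sumE mulNr (eq_bigr (fun k : 'I_m =>
      ((k.+1%:R * d < repr (f n) x)%R : nat)%:R)).
      by apply: layer_cake_bounds => //; exact: le_trans Md.
    move=> k _; rewrite /F indicE; congr (nat_of_bool _)%:R.
    by apply/idP/idP => [/set_mem[]//|h]; apply/mem_set.
  - by apply: rpredD => //; exact: rpredZ.
  - exact: ltW.
have [C C0 phiC] : exists2 C : R, 0 < C & forall u, `|phi u| <= C * `|u|.
  have /linear_bounded_continuous/linear_boundedP := cphi.
  by move=> /pinfty_ex_gt0[C C0 phiC]; exists C.
apply/eqP; rewrite eq_le; apply/andP; split; last first.
  by apply: lb_le_inf => [|_ [n _ <-]//]; exists `|phi (f 0%N)|, 0%N.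
apply/ler_addgt0Pl => e e0; rewrite addr0.
(* The approximation error then costs at most [C * d = e / 2], which leaves [e / 2] for the measures
   of the level sets. *)
pose d : R := e / (2 * C).
have d0 : 0 < d by rewrite divr_gt0// mulr_gt0.
have [m Md] : exists m : nat, M <= m%:R * d.
  exists (Num.bound `|M / d|); rewrite -ler_pdivrMr//.
  exact: le_trans (ler_norm _) (ltW (archi_boundP (normr_ge0 _))).
have : (fun n => d * \sum_(k < m) measure_of phi (D n (k.+1%:R * d))) @ \oo --> 0.
  rewrite -[X in _ --> X](mulr0 d); apply: cvgM; first exact: cvg_cst.
  rewrite -[X in _ --> X](@big1_eq _ 0 +%R 'I_m (index_enum 'I_m) xpredT).
  apply: (cvg_big (@add_continuous R)) => k _.
  by apply: cD; exact: mulr_gt0.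
(* An infimum is at most any of its terms, so a single sufficiently late [n] is enough. *)
move=> /cvgrPdist_lt/(_ (e / 2) (divr_gt0 e0 (ltr0Sn _ 1)))[n _ /(_ n (leqnn n))].
rewrite sub0r normrN => Sn.
have : `|phi (f n)| <= e.
  pose u := d *: \sum_(k < m) Linf_class (\1_(D n (k.+1%:R * d)) : K -> R).
  have phiu : phi u = d * \sum_(k < m) measure_of phi (D n (k.+1%:R * d)).
    by rewrite /u linearZ linear_sum.
  rewrite -[f n](subrK u) linearD (le_trans (ler_normD _ _))// [leRHS]splitr.
  rewrite lerD//; last by rewrite phiu ltW.
  apply: le_trans (phiC _) _.
  rewrite [leRHS](_ : _ = C * d); last by rewrite /d invfM; field; exact: lt0r_neq0.
  by rewrite ler_pM2l//; exact: approx.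
apply: le_trans; apply: ge_inf; last by exists n.
by exists 0 => _ [k _ <-].
Qed.

End CountablyAdditive.

Theorem theorem5p1 (R : realType) (K : topologicalType)
    (cK : compact [set: K]) (hK : hausdorff_space K)
    (phi : {linear Linf R K -> R^o}) (cphi : continuous phi) :
  sigma_order_continuous phi <-> countably_additive (measure_of phi).
Proof.
split; first exact: sigma_order_continuous_countably_additive.
exact: countably_additive_sigma_order_continuous.
Qed.
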